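(* Let $\mathcal{E}$ be a finite-dimensional Euclidean space, $\mathcal{M}\subseteq\mathcal{E}$ a smooth embedded submanifold, $h:\mathcal{E}\to\mathbb{R}^q$ a smooth map, and $\mathcal{K}\subseteq\mathcal{E}$ an open neighborhood of $\{X\in\mathcal{E}\mid h(X)=0\}$ such that the differential $\mathrm{D}h_X:\mathcal{E}\to\mathbb{R}^q$ has full rank $q$ for all $X\in\mathcal{K}$. Let $X\in\mathcal{K}\cap\mathcal{M}$, let $\mathcal{H}_X:=\{\tilde X\in\mathcal{E}\mid h(\tilde X)=h(X)\}$, and assume that $\mathcal{H}_X$ and $\mathcal{M}$ are intrinsically transversal at $X$. Put $S(X):=\mathrm{T}_{\mathcal{H}_X\cap\mathcal{M}}(X)$ and $\Phi_{\mathcal{M}}(X):=\mathcal{P}_{\mathrm{T}_{\mathcal{M}}(X)}\circ\mathrm{D}h_X^*:\mathbb{R}^q\to\mathrm{T}_{\mathcal{M}}(X)$. Then for all $\xi\in\mathcal{E}$, $$\mathcal{P}_{S(X)}(\xi)=\mathcal{P}_{\mathrm{T}_{\mathcal{M}}(X)}(\xi)-\Phi_{\mathcal{M}}(X)\big(\mathrm{D}h_X\circ\Phi_{\mathcal{M}}(X)\big)^{\dagger}\,\mathrm{D}h_X\big(\mathcal{P}_{\mathrm{T}_{\mathcal{M}}(X)}(\xi)\big).$$ If additionally $\mathcal{H}_X$ and $\mathcal{M}$ are transversal at $X$, i.e., $\mathrm{T}_{\mathcal{H}_X}(X)+\mathrm{T}_{\mathcal{M}}(X)=\mathcal{E}$,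 then $\mathrm{D}h_X\circ\Phi_{\mathcal{M}}(X):\mathbb{R}^q\to\mathbb{R}^q$ is invertible (so the Moore–Penrose pseudoinverse $\dagger$ is the ordinary inverse).
   Context: $\mathrm{T}_{\mathcal{S}}(X)$ is the Bouligand tangent cone of a set $\mathcal{S}$ at $X$ (the tangent space if $\mathcal{S}$ is a submanifold near $X$); $\mathrm{N}_{\mathcal{S}}(X)$ is the normal space of a submanifold. $\mathcal{P}_{\mathcal{C}}$ is the nearest-point projection onto $\mathcal{C}$, $\mathrm{D}h_X^*$ the adjoint of $\mathrm{D}h_X$, $\dagger$ the Moore–Penrose pseudoinverse. By the full-rank condition $\mathcal{H}_X$ is a smooth submanifold near $X$ with $\mathrm{T}_{\mathcal{H}_X}(X)=\ker\mathrm{D}h_X$. Two submanifolds $\mathcal{X},\mathcal{Y}$ are intrinsically transversal at $Z\in\mathcal{X}\cap\mathcal{Y}$ if there exist $\kappa\in(0,1]$ and a neighborhood of $Z$ such that for all $X'\in\mathcal{X}\setminus\mathcal{Y}$ and $Y'\in\mathcal{Y}\setminus\mathcal{X}$ in this neighborhood, with $u=(X'-Y')/\|X'-Y'\|$, $\max\{\mathrm{dist}(u,\mathrm{N}_{\mathcal{Y}}(Y')),\mathrm{dist}(u,-\mathrm{N}_{\mathcal{X}}(X'))\}\ge\kappa$. *)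

(* Defs.v *)
From HB Require Import structures.
From mathcomp Require Import all_boot all_order all_algebra.
From mathcomp Require Import sesquilinear.
From mathcomp Require Import boolp classical_sets functions reals topology.
From mathcomp Require Import normedtype sequences derive.

Set Implicit Arguments.
Unset Strict Implicit.
Unset Printing Implicit Defensive.

Import Order.TTheory GRing.Theory Num.Theory.
Import numFieldNormedType.Exports.

Local Open Scope classical_set_scope.
Local Open Scope ring_scope.

(* The norm that gives [E] its topology is the one of the inner product; finite
   dimension comes from the [vectType] structure. *)
HB.mixin Record isEuclidean (R : realType) E
    of NormedModule R E & Vector R E := {
  inner : {dot E for idfun} ;
  inner_norm : forall x : E, inner x x = `|x| ^+ 2
}.

#[short(type="euclideanType")]
HB.structure Definition Euclidean (R : realType) :=
  {E of NormedModule R E & Vector R E & isEuclidean R E}.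

(* [R^q] is ['rV[R]_q]. Its library norm is the sup norm, which is used below
   only through the topology and the differential; the Euclidean structure of
   [R^q] enters through [dotr] alone. *)
Definition dotr (R : realType) (q : nat) (u v : 'rV[R]_q) : R :=
  (u *m v^T) 0 0.

Section Euclidean.
Context {R : realType} {E : euclideanType R}.
Implicit Types (S C X Y M : set E) (x y z v w xi : E).

Definition dist x C : R := inf [set `|x - c| | c in C].

(* [P_C(xi)] is the set of all nearest points; [proj C xi] is its element when
   this set is a singleton, e.g. when [C] is a linear subspace. *)
Definition nearest C xi : set E :=
  [set p | C p /\ forall c, C c -> `|xi - p| <= `|xi - c|].

Definition proj C xi : E := xget 0 (nearest C xi).

Definition tangent_cone S x : set E :=
  [set v | exists (s : nat -> E) (t : nat -> R),
    [/\ forall k, S (s k), forall k, 0 < t k, s k @[k --> \oo] --> x,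
        t k @[k --> \oo] --> 0
      & (t k)^-1 *: (s k - x) @[k --> \oo] --> v]].

Definition normal_subspace S x : set E :=
  [set w | forall v, tangent_cone S x v -> inner w v = 0].

Definition intrinsically_transversal_at X Y z : Prop :=
  [/\ X z, Y z & exists2 kappa : R, 0 < kappa <= 1 &
    exists2 U : set E, nbhs z U &
      forall x' y', U x' -> U y' -> X x' -> ~ Y x' -> Y y' -> ~ X y' ->
        let u := `|x' - y'|^-1 *: (x' - y') in
        kappa <= Num.max (dist u (normal_subspace Y y'))
                         (dist u [set - w | w in normal_subspace X x'])].

Definition transversal_at X Y z : Prop :=
  [set v + w | v in tangent_cone X z & w in tangent_cone Y z] = setT.

Section Maps.
Context {q : nat}.
Implicit Types (f : E -> 'rV[R]_q).

Definition differential f x : 'Hom(E, 'rV[R]_q) := linfun ('d f x).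

(* Since [E] is finite-dimensional, [y |-> Df(y)] is C^k as soon as all
   [y |-> Df(y) v] are. *)
Fixpoint Ck_on (k : nat) (U : set E) f : Prop :=
  match k with
  | 0 => forall x, U x -> {for x, continuous f}
  | k'.+1 => (forall x, U x -> differentiable f x) /\
             forall v, Ck_on k' U (fun x => 'd f x v)
  end.

Definition smooth_on (U : set E) f : Prop := forall k, Ck_on k U f.

Definition full_rank (L : 'Hom(E, 'rV[R]_q)) : Prop := \dim (limg L) = q.

Definition adjoint (L : 'Hom(E, 'rV[R]_q)) : 'Hom('rV[R]_q, E) :=
  xget 0 [set A : 'Hom('rV[R]_q, E) |
            forall (y : 'rV[R]_q) (x : E), inner (A y) x = dotr y (L x)].

End Maps.

(* An embedded submanifold is given by local defining maps with values in a
   fixed [R^c], where [c] is the codimension ([c = 0] for open sets). *)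
Definition submanifold M : Prop :=
  exists c : nat, forall x, M x ->
    exists (U : set E) (g : E -> 'rV[R]_c),
      [/\ open U, U x, smooth_on U g, full_rank (differential g x)
        & M `&` U = [set y | g y = 0] `&` U].

End Euclidean.

(* Moore-Penrose pseudoinverse: the unique solution of the Penrose equations. *)
Section Pseudoinverse.
Context {R : realType} {q : nat}.

Definition selfadjoint (A : 'End('rV[R]_q)) : Prop :=
  forall u v, dotr (A u) v = dotr u (A v).

Definition mp_pinv (A : 'End('rV[R]_q)) : 'End('rV[R]_q) :=
  xget 0 [set B : 'End('rV[R]_q) |
            [/\ (A \o B \o A)%VF = A, (B \o A \o B)%VF = B,
                selfadjoint (A \o B)%VF & selfadjoint (B \o A)%VF]].

End Pseudoinverse.

Section Problem.
Context {R : realType} {E : euclideanType R} {q : nat}.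
Implicit Types (h : E -> 'rV[R]_q) (M : set E) (X : E).

Definition level_set h X : set E := [set Y | h Y = h X].

Definition Phi h M X (y : 'rV[R]_q) : E :=
  proj (tangent_cone M X) (adjoint (differential h X) y).

(* [Phi h M X] is linear when [tangent_cone M X] is a linear subspace, which
   makes this the endomorphism [y |-> Dh_X (Phi y)]. *)
Definition DhPhi h M X : 'End('rV[R]_q) :=
  linfun (fun y => differential h X (Phi h M X y)).

End Problem.

(* Main.v *)
(* By Lyusternik's theorem the tangent cones of the level set and of [M] at [X]
   are the kernels of the differentials of their defining maps. Intrinsic
   transversality makes the tangent cone of the intersection equal to the
   intersection of the tangent cones: given approximate points [a], [b] of the two
   sets near [X + t v], minimise |x - y| + d (|x - a| + |y - b|) over the product;
   if the minimiser missed the intersection, its unit vector (x - y)/|x - y| would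
   be within [d < kappa] of both normal spaces. What remains is linear algebra:
   with B = Dh P and P the orthogonal projection onto the tangent space of [M],
   the matrix B B^T has the range of B, so that P - B^T (B B^T)^+ B is the
   orthogonal projection onto ker Dh intersected with that tangent space. *)
From HB Require Import structures.
Require Import Defs.
From mathcomp Require Import all_boot all_order all_algebra.
From mathcomp Require Import sesquilinear.
From mathcomp Require Import boolp classical_sets functions reals topology.
From mathcomp Require Import normedtype sequences derive landau.
From mathcomp Require Import ring lra.

Set Implicit Arguments.
Unset Strict Implicit.
Unset Printing Implicit Defensive.

Import Order.TTheory GRing.Theory Num.Theory.
Import numFieldNormedType.Exports.
Import VectorInternalTheory.

Local Open Scope classical_set_scope.
Local Open Scope ring_scope.

(** * Inner product calculus on [E] and on row vectors *)

Section Inner.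
Context {R : realType} {E : euclideanType R}.
Implicit Types (x y z : E).

Implicit Types a : R.

Lemma innerC x y : inner x y = inner y x.
Proof. by rewrite hermC expr0 mul1r. Qed.

Lemma innerZl a x y : inner (a *: x) y = a * inner x y.
Proof. exact: linearZl_LR. Qed.

Lemma innerZr a x y : inner x (a *: y) = a * inner x y.
Proof. by rewrite innerC innerZl innerC. Qed.

Lemma innerDl x y z : inner (x + y) z = inner x z + inner y z.
Proof. exact: linearDl. Qed.

Lemma innerDr x y z : inner x (y + z) = inner x y + inner x z.
Proof. exact: linearDr. Qed.

Lemma innerNl x y : inner (- x) y = - inner x y.
Proof. exact: linearNl. Qed.

Lemma innerNr x y : inner x (- y) = - inner x y.
Proof. exact: linearNr. Qed.

Lemma inner0r x : inner x 0 = 0.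
Proof. exact: linear0r. Qed.

Lemma inner_eq0 x : inner x x = 0 -> x = 0.
Proof. by rewrite inner_norm => /eqP; rewrite sqrf_eq0 normr_eq0 => /eqP. Qed.

Lemma inner_inj x y : (forall z, inner x z = inner y z) -> x = y.
Proof.
move=> xy; apply/eqP; rewrite -subr_eq0; apply/eqP/inner_eq0.
by rewrite innerDl innerNl xy subrr.
Qed.

Lemma normD_sqr x y : `|x + y| ^+ 2 = `|x| ^+ 2 + 2 * inner x y + `|y| ^+ 2.
Proof.
rewrite -!inner_norm innerDl !innerDr (innerC y x).
by ring.
Qed.

Lemma cauchy_schwarz x y : `|inner x y| <= `|x| * `|y|.
Proof.
have [->|y0] := eqVneq y 0; first by rewrite inner0r !normr0 mulr0.
have y2 : 0 < `|y| ^+ 2 by rewrite exprn_gt0 ?normr_gt0.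
rewrite -ler_sqr ?nnegrE ?mulr_ge0 ?normr_ge0// exprMn -normrX ger0_norm ?sqr_ge0//.
rewrite -subr_ge0 -(pmulr_rge0 _ y2).
suff -> : `|y| ^+ 2 * (`|x| ^+ 2 * `|y| ^+ 2 - inner x y ^+ 2) =
   `| `|y| ^+ 2 *: x - inner x y *: y| ^+ 2 by rewrite sqr_ge0.
rewrite normD_sqr innerNr innerZl innerZr normrN !normrZ !exprMn.
rewrite !real_normK ?num_real// -!inner_norm.
 by ring.
Qed.

End Inner.

Section Dotr.
Context {R : realType} {q : nat}.
Implicit Types (u v w : 'rV[R]_q).

Lemma dotrC u v : dotr u v = dotr v u.
Proof. by rewrite /dotr -[u *m v^T]trmxK trmx_mul trmxK mxE. Qed.

Lemma dotrBl u v w : dotr (u - v) w = dotr u w - dotr v w.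
Proof. by rewrite /dotr mulmxBl !mxE. Qed.

Lemma dotr_eq0 u : dotr u u = 0 -> u = 0.
Proof.
rewrite /dotr mxE => /eqP; rewrite psumr_eq0; last first.
  by move=> i _; rewrite mxE -expr2 sqr_ge0.
move=> /allP u0; apply/rowP => i.
have := u0 i (mem_index_enum i); rewrite mxE implyTb -expr2 sqrf_eq0 => /eqP ->.
by rewrite mxE.
Qed.

Lemma dotr_inj u v : (forall w, dotr u w = dotr v w) -> u = v.
Proof.
move=> uv; apply/eqP; rewrite -subr_eq0; apply/eqP/dotr_eq0.
by rewrite dotrBl uv subrr.
Qed.

End Dotr.

(** * Riesz representation, adjoints and orthogonal projections *)

Section Riesz.
Context {R : realType} {E : euclideanType R}.

Let e (i : 'I_(dim E)) : E := r2v (delta_mx 0 i).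

Let coord_sum (x : E) : x = \sum_i (v2r x) 0 i *: e i.
Proof.
rewrite -[LHS]v2rK [in LHS](row_sum_delta (v2r x)) linear_sum.
by apply: eq_bigr => i _; rewrite linearZ.
Qed.

Let J (x : E) : 'rV[R]_(dim E) := \row_i inner x (e i).

Let J_linear : linear J.
Proof. by move=> a x y; apply/rowP => i; rewrite !mxE linearPl. Qed.
HB.instance Definition _ := GRing.isLinear.Build R E 'rV[R]_(dim E) _ J J_linear.

Let J_surj (r : 'rV[R]_(dim E)) : exists x, J x = r.
Proof.
(* Composing with [r2v] makes [J] an endomorphism of a finite-dimensional space, so injectivity
   gives surjectivity. *)
pose f : 'End(E) := linfun (r2v \o J).
have f0 : lker f == 0%VS.
  apply/lker0P => x y; rewrite !lfunE/= => /r2v_inj /rowP xy.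
  apply: inner_inj => z; rewrite (coord_sum z) !linear_sumr/=.
  apply: eq_bigr => i _; rewrite !innerZr.
  by have := xy i; rewrite !mxE => ->.
exists (f^-1%VF (r2v r)); apply: (@r2v_inj _ E).
by rewrite -[RHS](lker0_lfunVK f0) lfunE.
Qed.

Lemma riesz (l : E -> R) :
  linear_for *%R l -> exists a : E, forall x, inner a x = l x.
Proof.
move=> ll; have l0 : l 0 = 0.
  have := ll (-1) 0 0; rewrite scaler0 addr0 mulN1r addNr; exact.
have [a Ja] := J_surj (\row_i l (e i)).
exists a => x; rewrite (coord_sum x) linear_sumr/=.
have -> : l (\sum_i (v2r x) 0 i *: e i) = \sum_i (v2r x) 0 i * l (e i).
  elim/big_rec2: _ => [//|i u w _ <-]; exact: ll.
apply: eq_bigr => i _; rewrite innerZr.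
by move/rowP: Ja => /(_ i); rewrite !mxE => ->.
Qed.

End Riesz.

Section Adjoint.
Context {R : realType} {E : euclideanType R} {q : nat}.
Implicit Types (L : 'Hom(E, 'rV[R]_q)) (x v xi p : E) (y : 'rV[R]_q).

(** [adjoint] is a choice with default [0], so some adjoint must be exhibited: each coordinate of
    [L] is represented by a Riesz vector. *)
Lemma adjointP L y x : inner (adjoint L y) x = dotr y (L x).
Proof.
have /choice[a aE] : forall i, exists a : E, forall x, inner a x = L x 0 i.
  by move=> i; apply: riesz => c u v; rewrite linearP !mxE.
pose A (y : 'rV[R]_q) : E := \sum_i y 0 i *: a i.
have Al : linear A.
  move=> c u v; rewrite /A scaler_sumr -big_split/=; apply: eq_bigr => i _.
  by rewrite !mxE scalerDl scalerA.
pose lA : {linear 'rV[R]_q -> E} :=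
  HB.pack A (GRing.isLinear.Build R 'rV[R]_q E _ A Al).
suff H : exists A : 'Hom('rV[R]_q, E),
    forall (y : 'rV[R]_q) (x : E), inner (A y) x = dotr y (L x).
  by rewrite /adjoint; have := xgetPex 0 H; exact.
exists (linfun lA) => z w; rewrite lfunE/= /A.
rewrite /dotr mxE linear_sumlz; apply: eq_bigr => i _.
by rewrite [LHS]innerZl aE mxE.
Qed.

Lemma full_rank_surj L : full_rank L -> forall y, L (L^-1%VF y) = y.
Proof.
move=> Lq y; apply: limg_lfunVK.
suff -> : limg L = fullv by rewrite memvf.
by apply/eqP; rewrite eqEdim subvf Lq dimvf [dim _]mul1n leqnn.
Qed.

Lemma adjoint_inj L y : full_rank L -> adjoint L y = 0 -> y = 0.
Proof.
move=> /full_rank_surj Ls Ly; apply: dotr_eq0.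
by rewrite -{2}(Ls y) -adjointP Ly innerC inner0r.
Qed.

(** With L^T the adjoint, the projection is 1 - L^T (L L^T)^-1 L. Here L L^T is injective, since <L
    L^T u, u> = |L^T u|^2 and L^T is injective when [L] is onto. *)
Lemma ker_projection L : full_rank L -> exists P : 'End(E), forall x,
  L (P x) = 0 /\ forall v, L v = 0 -> inner (x - P x) v = 0.
Proof.
move=> Lr; pose A : 'End('rV[R]_q) := (L \o adjoint L)%VF.
have AE u : A u = L (adjoint L u) by rewrite comp_lfunE.
have A0 : lker A == 0%VS.
  apply/lker0P => u v /eqP; rewrite -subr_eq0 -linearB => /eqP Auv.
  have /(congr1 (dotr (u - v))) := etrans (esym (AE (u - v))) Auv; rewrite -adjointP.
  rewrite /dotr linear0 mulmx0 mxE => /inner_eq0/(adjoint_inj Lr)/eqP.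
  by rewrite subr_eq0 => /eqP.
exists (\1 - (adjoint L \o A^-1 \o L))%VF => x.
rewrite add_lfunE opp_lfunE !comp_lfunE id_lfunE; split.
  rewrite linearB/=; set w := (A^-1%VF _).
  by rewrite -AE lker0_lfunVK// subrr.
move=> v Lv; rewrite opprB addrC subrK adjointP Lv.
by rewrite /dotr linear0 mulmx0 mxE.
Qed.

End Adjoint.

(** Pythagoras: closure under [c |-> p - c] makes [xi - p] orthogonal to [p - c], so |xi - c|^2 =
    |xi - p|^2 + |p - c|^2. *)
Lemma nearest_orthogonal {R : realType} {E : euclideanType R} (C : set E)
    (xi p : E) :
  C p -> (forall c, C c -> C (p - c)) ->
  (forall v, C v -> inner (xi - p) v = 0) -> nearest C xi = [set p].
Proof.
move=> Cp CB pC.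
have pyth c : C c -> `|xi - c| ^+ 2 = `|xi - p| ^+ 2 + `|p - c| ^+ 2.
  move=> Cc; rewrite -[xi - c](subrKA p) (normD_sqr (xi - p)).
  by rewrite pC ?mulr0 ?addr0//; exact: CB.
apply/seteqP; split=> [c [Cc cmin]|_ ->] /=.
  have := cmin p Cp; rewrite -ler_sqr ?nnegrE ?normr_ge0// (pyth c Cc).
  rewrite gerDl => pc; apply/esym/eqP; rewrite -subr_eq0 -normr_eq0.
  by rewrite -sqrf_eq0 eq_le pc sqr_ge0.
split=> // c Cc; rewrite -ler_sqr ?nnegrE ?normr_ge0// (pyth c Cc).
by rewrite lerDl sqr_ge0.
Qed.

Lemma proj_nearest {R : realType} {E : euclideanType R} (C : set E) (xi p : E) :
  nearest C xi = [set p] -> proj C xi = p.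
Proof.
move=> Cp; have : nearest C xi (proj C xi).
  by apply: xgetPex; rewrite Cp; exists p.
by rewrite Cp.
Qed.

(** * Existence of the Moore-Penrose pseudoinverse *)

Section Pinv.
Context {R : realType} {q : nat}.

Lemma row_free_gram m (B : 'M[R]_(m, q)) : row_free B -> B *m B^T \in unitmx.
Proof.
move=> Bf; rewrite -row_free_unit -kermx_eq0; apply/eqP/row_matrixP => i.
rewrite row0; set u := row i _.
have uk : u *m (B *m B^T) = 0.
  by apply/sub_kermxP; exact: row_sub.
have : dotr (u *m B) (u *m B) = 0.
  by rewrite /dotr trmx_mul mulmxA -(mulmxA u) uk mul0mx mxE.
move/dotr_eq0 => uB.
by apply: (row_free_inj Bf); rewrite uB mul0mx.
Qed.

(** Only existence is at stake, as [mp_pinv] is picked by choice. A full rank factorisation M = C S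
    provides the solution S^T (S S^T)^-1 (C^T C)^-1 C^T. *)
Lemma mp_pinvP (A : 'End('rV[R]_q)) :
  [/\ (A \o mp_pinv A \o A)%VF = A, (mp_pinv A \o A \o mp_pinv A)%VF = mp_pinv A,
     selfadjoint (A \o mp_pinv A)%VF & selfadjoint (mp_pinv A \o A)%VF].
Proof.
suff H : exists B : 'End('rV[R]_q), [/\ (A \o B \o A)%VF = A,
   (B \o A \o B)%VF = B, selfadjoint (A \o B)%VF & selfadjoint (B \o A)%VF].
  exact: (xgetPex 0 H).
pose M := lin1_mx A.
have AE u : A u = u *m M by rewrite mul_rV_lin1.
have [r [C [S [MCS Cf Sf]]]] : exists r (C : 'M_(q, r)) (S : 'M_(r, q)),
    [/\ M = C *m S, row_free C^T & row_free S].
  exists (\rank M), (col_base M), (row_base M).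
  rewrite mulmx_base row_base_free /row_free mxrank_tr.
  by split=> //; exact: col_base_full.
have Su : S *m S^T \in unitmx by exact: row_free_gram.
have Cu : C^T *m C \in unitmx by rewrite -{2}(trmxK C); exact: row_free_gram.
pose N := S^T *m invmx (S *m S^T) *m invmx (C^T *m C) *m C^T.
have MN : M *m N = C *m invmx (C^T *m C) *m C^T.
  rewrite MCS /N !mulmxA -(mulmxA C S) -(mulmxA C (S *m _)) mulmxV//.
  by rewrite mulmx1.
have NM : N *m M = S^T *m invmx (S *m S^T) *m S.
  rewrite MCS /N !mulmxA -(mulmxA _ C^T C) -(mulmxA _ _ (C^T *m C)) mulVmx//.
  by rewrite mulmx1.
have MNM : M *m (N *m M) = M.
  rewrite NM {1}MCS !mulmxA -(mulmxA C S) -(mulmxA C (S *m _)) mulmxV//.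
  by rewrite mulmx1 -MCS.
have NMN : N *m (M *m N) = N.
  rewrite MN {1}/N !mulmxA -(mulmxA _ C^T C) -(mulmxA _ _ (C^T *m C)) mulVmx//.
  by rewrite mulmx1.
have symV n (K : 'M[R]_n) : K^T = K -> (invmx K)^T = invmx K.
  by move=> KK; rewrite trmx_inv KK.
have selfmx (K : 'M[R]_q) : K^T = K -> forall u v : 'rV_q,
   dotr (u *m K) v = dotr u (v *m K).
  by move=> KK u v; rewrite /dotr trmx_mul KK mulmxA.
pose B : 'End('rV[R]_q) := linfun (mulmxr N).
have BE u : B u = u *m N by rewrite lfunE.
exists B; split.
- by apply/lfunP => u; rewrite !comp_lfunE !AE BE -2!mulmxA MNM.
- by apply/lfunP => u; rewrite !comp_lfunE !BE AE -2!mulmxA NMN.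
(* Matrices act on row vectors from the right, so [A \o B] has matrix [N *m M]. *)
- move=> u v; rewrite !comp_lfunE !AE !BE -!(mulmxA _ N) NM; apply: selfmx.
  by rewrite !trmx_mul trmxK symV ?mulmxA// trmx_mul trmxK.
- move=> u v; rewrite !comp_lfunE !BE !AE -!(mulmxA _ M) MN; apply: selfmx.
  by rewrite !trmx_mul trmxK symV ?mulmxA// trmx_mul trmxK.
Qed.
End Pinv.

(** * Linear algebra of the projection formula, the tangent space of [M] being a kernel *)

Section ConstrainedProjection.
Context {R : realType} {E : euclideanType R} {q c : nat}.
Variables (h : E -> 'rV[R]_q) (M : set E) (X : E) (G : 'Hom(E, 'rV[R]_c)).
Hypotheses (Gr : full_rank G) (TM : tangent_cone M X = [set v | G v = 0]).

Let L := differential h X.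
Let A := DhPhi h M X.
Let B := mp_pinv A.

(** [P] is the orthogonal projection onto ker G. The last two items say that [A] is L P L^T, hence
    positive semidefinite with the kernel of P L^T. *)
Let projection : exists P : 'End(E), [/\ forall x, G (P x) = 0,
  forall x v, G v = 0 -> inner (x - P x) v = 0,
  forall x y, inner (P x) y = inner x (P y),
  forall x, proj (tangent_cone M X) x = P x &
  (forall y, dotr y (A y) = inner (P (adjoint L y)) (P (adjoint L y))) /\
  (forall y, A y = L (P (adjoint L y)))].
Proof.
have [P PE] := ker_projection Gr.
have GP x : G (P x) = 0 by have [] := PE x.
have oP x v : G v = 0 -> inner (x - P x) v = 0 by have [_] := PE x; exact.
have Pproj x : proj (tangent_cone M X) x = P x.
  apply: proj_nearest; apply: nearest_orthogonal; rewrite TM//=.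
  - by move=> v Gv; rewrite linearB/= GP Gv subrr.
  - exact: oP.
have AE y : A y = L (P (adjoint L y)).
  rewrite /A /DhPhi.
  (* [lfunE] computes [linfun] of linear maps only, so the function is first rewritten as a
     composition of such maps. *)
  have -> : (fun y => differential h X (Phi h M X y)) =
            (L \o P \o adjoint L)%VF.
    by apply/funext => z; rewrite !comp_lfunE /Phi Pproj.
  by rewrite lfunE /= !comp_lfunE.
exists P; split=> //.
- move=> x y; transitivity (inner (P x) (P y)).
    rewrite -[y in LHS](subrK (P y)) innerDr (innerC (P x) (y - _)) oP ?add0r//.
  by rewrite -[x in RHS](subrK (P x)) innerDl oP ?add0r.
- split=> // y; rewrite AE -adjointP -{1}(subrK (P (adjoint L y)) (adjoint L y)).
  by rewrite innerDl oP ?add0r.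
Qed.

Let A_selfadjoint u v : dotr (A u) v = dotr u (A v).
Proof.
have [P [_ _ sP _ [_ AE]]] := projection.
by rewrite !AE dotrC -!adjointP -sP innerC.
Qed.

Lemma nearest_level_tangent xi :
  nearest [set v | L v = 0 /\ G v = 0] xi =
    [set proj (tangent_cone M X) xi -
      Phi h M X (B (L (proj (tangent_cone M X) xi)))].
Proof.
have [P [GP oP sP PM [PA AE]]] := projection.
have [ABA _ sAB _] := mp_pinvP A.
(* A B is the orthogonal projection onto the range of the selfadjoint [A], so y - A B y lies in ker
   A, which is the kernel of P L^T. *)
have res0 y : P (adjoint L (y - A (B y))) = 0.
  set w := y - _; have Aw : A w = 0.
    apply: dotr_inj => z; rewrite A_selfadjoint dotrBl.
    have := sAB y (A z); rewrite !comp_lfunE => ->.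
    have := congr1 (fun f : 'End(_) => f z) ABA; rewrite !comp_lfunE => ->.
    by rewrite subrr /dotr mul0mx mxE.
  apply: inner_eq0; rewrite -PA Aw.
  by rewrite /dotr linear0 mulmx0 mxE.
(* L P is adjoint to P L^T, so [res0] makes L P x - A B L P x orthogonal to every [y]. *)
have LPx x : A (B (L (P x))) = L (P x).
  apply/esym/eqP; rewrite -subr_eq0; apply/eqP/dotr_inj => y.
  have := sAB (L (P x)) y; rewrite dotrBl !comp_lfunE => ->.
  rewrite !(dotrC (L (P x))) -dotrBl -adjointP -sP res0.
  by rewrite innerC inner0r /dotr mul0mx mxE.
rewrite /Phi !PM; apply: nearest_orthogonal => /=.
- rewrite !linearB/= !GP subr0; split=> //.
  by rewrite -AE LPx subrr.
- by move=> v [Lv Gv]; rewrite !linearB/= -AE LPx !GP Lv Gv !subrr.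
(* For [v] in both kernels P v = v, hence <P L^T z, v> = <z, L v> = 0. *)
- move=> v [Lv Gv]; rewrite opprB addrCA innerDl oP// addr0.
  have Pv : P v = v.
    apply/esym/eqP; rewrite -subr_eq0; apply/eqP/inner_eq0.
    by apply: oP; rewrite linearB/= GP Gv subrr.
  by rewrite sP Pv adjointP Lv /dotr linear0 mulmx0 mxE.
Qed.

(** If A y = 0 then L^T y is orthogonal to ker G, and it is always orthogonal to ker L. The two
    kernels span, so L^T y = 0 and y = 0. Thus [A] is invertible, and A B A = A makes [B] its
    inverse. *)
Lemma DhPhi_inverse : full_rank L ->
  (forall x, exists v w, [/\ L v = 0, G w = 0 & x = v + w]) ->
  cancel (L \o Phi h M X) B /\ cancel B (L \o Phi h M X).
Proof.
move=> Lr tr; have [P [GP oP sP PM [PA AE]]] := projection.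
have [ABA _ _ _] := mp_pinvP A.
have A0 : lker A == 0%VS.
  have A_inj y : A y = 0 -> y = 0.
    move=> Ay; have PLy : P (adjoint L y) = 0.
      apply: inner_eq0; rewrite -PA Ay.
      by rewrite /dotr linear0 mulmx0 mxE.
    apply: (adjoint_inj Lr); apply: inner_eq0.
    have [v [w [Lv Gw]]] := tr (adjoint L y) => {2}->.
    rewrite innerDr adjointP Lv /dotr linear0 mulmx0 mxE add0r.
    by have := oP (adjoint L y) _ Gw; rewrite PLy subr0.
  apply/lker0P => u v Auv; apply/eqP; rewrite -subr_eq0; apply/eqP/A_inj.
  by apply/eqP; rewrite linearB subr_eq0; apply/eqP.
have LPhi : L \o Phi h M X = A by apply/funext => y; rewrite /= /Phi PM AE.
have AK : cancel A B.
  move=> y; move/lker0P: A0; apply.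
  have := congr1 (fun f : 'End(_) => f y) ABA.
  by rewrite !comp_lfunE.
rewrite LPhi; split=> // y.
by rewrite -{1}[y](lker0_lfunVK A0) AK lker0_lfunVK.
Qed.

End ConstrainedProjection.

(** * Sup norm bounds, compactness of closed balls, first-order expansion *)

Lemma rV_norm_coord {R : realType} {n : nat} (u : 'rV[R]_n) i : `|u 0 i| <= `|u|.
Proof.
rewrite [leRHS]/Num.norm/= mx_normrE.
by apply/bigmax_geP; right => /=; exists (0, i).
Qed.

Lemma rV_norm_le {R : realType} {n : nat} (u : 'rV[R]_n) c :
  0 <= c -> (forall i, `|u 0 i| <= c) -> `|u| <= c.
Proof.
move=> c0 uc; rewrite [leLHS]/Num.norm/= mx_normrE.
by apply/bigmax_leP; split=> // -[i j] _ /=; rewrite (ord1 i).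
Qed.

Lemma linear_rV_bound {R : realType} {V : normedModType R} {n : nat}
    (f : {linear 'rV[R]_n -> V}) : exists2 C, 0 < C & forall u, `|f u| <= C * `|u|.
Proof.
exists (1 + \sum_i `|f (delta_mx 0 i)|).
  by rewrite ltr_pwDl// sumr_ge0.
move=> u; rewrite {1}(row_sum_delta u) linear_sum mulrDl mul1r.
rewrite (le_trans (ler_norm_sum _ _ _))// -[leLHS]add0r lerD//.
rewrite mulr_suml ler_sum// => i _.
by rewrite linearZ normrZ mulrC ler_wpM2l// rV_norm_coord.
Qed.

Lemma dist_continuous {R : realType} {V : normedModType R} (x : V) :
  continuous (fun y : V => `|y - x|).
Proof. by move=> y; apply: cvg_norm; apply: cvgB; [exact: cvg_id|exact: cvg_cst]. Qed.

(** The ball is the continuous image under [r2v] of a closed set of coordinate vectors; that set is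
    bounded by Cauchy-Schwarz, its coordinates being inner products with Riesz vectors. *)
Lemma compact_cball {R : realType} {E : euclideanType R} (x : E) (r : R) :
  compact [set y | `|y - x| <= r].
Proof.
have [C C0 rC] := linear_rV_bound (@r2v R E : {linear _ -> _}).
have r2vc : continuous (@r2v R E).
  apply: (@bounded_linear_continuous _ _ _ (@r2v R E : {linear _ -> _})).
  apply/linear_boundedP; near=> c => y; apply: le_trans (rC y) _.
  by rewrite ler_wpM2r//; near: c; apply: nbhs_pinfty_ge; rewrite num_real.
have /choice[a aE] : forall i, exists a : E, forall y : E, inner a y = v2r y 0 i.
  by move=> i; apply: riesz => c u v; rewrite linearP !mxE.
have -> : [set y | `|y - x| <= r] = r2v @` [set v : 'rV[R]_(dim E) | `|r2v v - x| <= r].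
  apply/seteqP; split=> [y yr|_ [v vr <-]]//=.
  by exists (v2r y) => //=; rewrite ?v2rK.
apply: continuous_compact.
  exact: continuous_subspaceT.
apply: bounded_closed_compact.
  exists ((r + `|x|) * \sum_i `|a i|); split; first by rewrite num_real.
  move=> c cr v /= vr; apply: le_trans (ltW cr).
  have rx : `|r2v v| <= r + `|x| by rewrite -lerBlDr (le_trans (lerB_dist _ _)).
  have rx0 : 0 <= r + `|x| by rewrite (le_trans _ rx).
  apply: rV_norm_le => [|i]; first by rewrite mulr_ge0// sumr_ge0.
  rewrite -{1}(r2vK v) -aE (le_trans (cauchy_schwarz _ _))// mulrC ler_pM//.
  by rewrite (bigD1 i)//= lerDl sumr_ge0.
rewrite (_ : [set v | _] = (fun v => `|r2v v - x|) @^-1` [set z | z <= r])//.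
apply: preimage_closed; last exact: closed_le.
move=> v _; apply: (@continuous_comp _ _ _ (@r2v R E) (fun y => `|y - x|)).
  exact: r2vc.
exact: dist_continuous.
Unshelve. all: by end_near. Qed.

Lemma differentiable_near {R : realType} {V W : normedModType R} (g : V -> W) x e :
  differentiable g x -> 0 < e ->
  \forall y \near x, `|g y - g x - 'd g x (y - x)| <= e * `|y - x|.
Proof.
move=> /diffP[_ dg] e0.
have /eqaddoP/(_ e e0) := funext dg.
rewrite /= lim_id//; apply: filterS => y.
by rewrite -(addrA (g y)) -opprD.
Qed.

(** * Tangent cones and derivable cones *)

Section TangentCone.
Context {R : realType} {E : euclideanType R}.
Implicit Types (S T : set E) (x v : E).

(* The curve-like half of the tangent cone: unlike the sequences in
   [tangent_cone], one scale [t] serves several vectors and sets at once. *)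
Definition derivable_cone S x : set E :=
  [set v | forall e, 0 < e -> exists2 r, 0 < r &
    forall t, 0 < t < r -> exists2 s, S s & `|s - (x + t *: v)| <= e * t].

Lemma derivable_tangent_cone S x v : derivable_cone S x v -> tangent_cone S x v.
Proof.
move=> Sv.
have step (k : nat) : exists st : E * R, [/\ S st.1, 0 < st.2, st.2 <= k.+1%:R^-1 &
    `|st.1 - (x + st.2 *: v)| <= k.+1%:R^-1 * st.2].
  have k0 : 0 < k.+1%:R^-1 :> R by rewrite invr_gt0.
  have [r r0 rS] := Sv _ k0.
  (* Halving keeps the scale strictly below [r]; the bound 1/(k+1) makes the scales tend to 0. *)
  pose t := Num.min (r / 2) k.+1%:R^-1.
  have t0 : 0 < t by rewrite lt_min k0 divr_gt0.
  have tr : t < r.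
    by rewrite gt_min ltr_pdivrMr// mulr_natr mulr2n ltrDl r0.
  have [|s Ss sle] := rS t; first by rewrite t0.
  by exists (s, t); split=> //=; rewrite ge_min lexx orbT.
have [st stP] := choice step.
have hc : (fun k : nat => k.+1%:R^-1 : R) @ \oo --> (0 : R) by exact: cvg_harmonic.
have tc : (fun k => (st k).2) @ \oo --> (0 : R).
  apply: (@squeeze_cvgr _ _ _ _ (cst 0) (fun k : nat => k.+1%:R^-1 : R)) => //.
  - by near=> k; have [_ t0 tk _] := stP k; rewrite ltW.
  - exact: cvg_cst.
have dc : (fun k => (st k).2^-1 *: ((st k).1 - x)) @ \oo --> v.
  apply/cvgrPdist_le => e e0.
  near=> k; have [_ t0 _] := stP k; rewrite -ler_pdivrMr// => sk.
  have -> : v - (st k).2^-1 *: ((st k).1 - x) =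
      - ((st k).2^-1 *: ((st k).1 - (x + (st k).2 *: v))).
    by rewrite opprD addrA (scalerBr _ (_ - _)) scalerA mulVf ?gt_eqF// scale1r opprB.
  rewrite normrN normrZ gtr0_norm ?invr_gt0// mulrC (le_trans sk)//.
  near: k; move/cvgrPdist_le : hc => /(_ e e0); apply: filterS => k.
  by rewrite sub0r normrN ger0_norm ?invr_ge0.
exists (fun k => (st k).1), (fun k => (st k).2); split=> //.
- by move=> k; have [] := stP k.
- by move=> k; have [] := stP k.
rewrite (_ : (fun k => (st k).1) = (fun k => x +
    (st k).2 *: ((st k).2^-1 *: ((st k).1 - x)))); last first.
  apply/funext => k; have [_ t0 _ _] := stP k.
  by rewrite scalerA mulfV ?gt_eqF// scale1r addrC subrK.
rewrite -[X in _ --> X]addr0 -(scale0r v).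
by apply: cvgD; [exact: cvg_cst|exact: cvgZ].
Unshelve. all: by end_near. Qed.

Lemma sub_tangent_cone S T x : S `<=` T -> tangent_cone S x `<=` tangent_cone T x.
Proof.
move=> ST v [s [t [Ss t0 sx tx stv]]]; exists s, t; split=> // k; exact: ST.
Qed.

End TangentCone.

(** * Tangent cones of level sets and Lyusternik's theorem *)

Section Regular.
Context {R : realType} {E : euclideanType R} {q : nat}.
Implicit Types (S U : set E) (g : E -> 'rV[R]_q) (a : 'rV[R]_q) (x v : E).

(** [g] is eventually constant along the sequence, so |'d g x (s k - x)| <= e |s k - x|; dividing by
    [t k] and passing to the limit gives |'d g x v| <= e |v| for every e > 0. *)
Lemma tangent_cone_sub_ker S U g a x v :
  nbhs x U -> S `&` U `<=` [set y | g y = a] -> g x = a -> differentiable g x ->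
  tangent_cone S x v -> 'd g x v = 0.
Proof.
move=> Ux SU gx dg [s [t [Ss t0 sx tx stv]]].
have dc : 'd g x ((t k)^-1 *: (s k - x)) @[k --> \oo] --> 'd g x v.
  by apply: (@cvg_comp _ _ _ _ ('d g x) _ (nbhs v)) stv _; exact: diff_continuous.
have e_le e : 0 < e -> `|'d g x v| <= e * `|v|.
  move=> e0.
  have ec : e * `|(t k)^-1 *: (s k - x)| @[k --> \oo] --> e * `|v|.
    by apply: cvgM; [exact: cvg_cst|exact: cvg_norm].
  apply: (ler_cvg_to (cvg_norm dc) ec).
  near=> k.
  have [Uk /=] : (U `&` [set y | `|g y - g x - 'd g x (y - x)| <= e * `|y - x|]) (s k).
    by near: k; apply: sx; exact: filterI Ux (differentiable_near dg e0).
  rewrite (SU (s k))// gx subrr sub0r normrN => dk.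
  rewrite linearZ/= !normrZ mulrCA ler_wpM2l//.
apply/eqP; rewrite -normr_eq0 eq_le normr_ge0 andbT.
have [->|v0] := eqVneq v 0; first by rewrite linear0 normr0.
apply/ler_addgt0Pr => e e0; rewrite add0r.
have := e_le (e / `|v|); rewrite divfK ?normr_eq0//; apply.
by rewrite divr_gt0 ?normr_gt0.
Unshelve. all: by end_near. Qed.

End Regular.

Lemma nbhs_dist {R : realType} {V : normedModType R} (x : V) (U : set V) :
  nbhs x U -> exists2 r, 0 < r & forall y, `|y - x| < r -> U y.
Proof.
move=> /nbhs_normP[r /= r0 rU]; exists r => // y yr; apply: rU => /=.
by rewrite /ball_/= distrC.
Qed.

Lemma small_scale {R : realType} (r m : R) : 0 < r -> 0 <= m ->
  exists2 t, 0 < t <= 1 & t * m < r.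
Proof.
move=> r0 m0; have m1 : 0 < m + 1 by rewrite ltr_wpDl.
exists (Num.min 1 (r / (m + 1))).
  by rewrite ge_min lexx lt_min ltr01 divr_gt0.
apply: le_lt_trans (_ : r / (m + 1) * m < r).
  by rewrite ler_wpM2r// ge_min lexx orbT.
by rewrite mulrAC ltr_pdivrMr// ltr_pM2l// ltrDl.
Qed.

Section Lyusternik.
Context {R : realType} {E : euclideanType R} {q : nat}.
Variables (U S : set E) (g : E -> 'rV[R]_q) (a : 'rV[R]_q) (x : E).
Variable A : {linear 'rV[R]_q -> E}.
Hypotheses (Ux : nbhs x U) (dg : forall y, U y -> differentiable g y).
Hypotheses (dgc : forall v, {for x, continuous (fun y => 'd g y v)}).
Hypotheses (dgA : forall w, 'd g x (A w) = w) (gx : g x = a).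
Hypothesis US : U `&` [set y | g y = a] `<=` S.

Let near_right_inverse :
  \forall y \near x, forall w, `|'d g y (A w) - w| <= 4^-1 * `|w|.
Proof.
(* A bound per basis vector, to be summed over [q] of them into 1/4; q + 1 in place of q covers q =
   0. *)
pose c : R := (4 * q.+1%:R)^-1.
have c0 : 0 < c by rewrite invr_gt0 mulr_gt0// ltr0n.
have : \forall y \near x, forall i : 'I_q,
    `|'d g y (A (delta_mx 0 i)) - delta_mx 0 i| <= c.
  apply: filter_forall => i; have /cvgrPdist_le/(_ c c0) := dgc (v := A (delta_mx 0 i)).
  by apply: filterS => y; rewrite dgA distrC.
apply: filterS => y yc w.
rewrite {1 2}(row_sum_delta w) !linear_sum -big_split/=.
apply: le_trans (ler_norm_sum _ _ _) _.
apply: le_trans (_ : \sum_(i < q) `|w| * c <= _).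
  apply: ler_sum => i _; rewrite [A _]linearZ [X in X - _]linearZ -scalerBr normrZ.
  rewrite ler_pM//.
  exact: rV_norm_coord.
rewrite sumr_const card_ord -[leLHS]mulr_natr mulrC mulrCA mulrC ler_wpM2r// /c.
rewrite invfM mulrCA ler_piMr ?invr_ge0//.
by rewrite ler_pdivrMr ?ltr0n// mul1r ler_nat.
Qed.

(* The penalised residual [|g s - a| + d |s - (x + t v)|] has a minimiser on a
   small ball, and a Newton step from it would decrease the residual unless it
   already solves [g s = a]. *)
Lemma lyusternik v : 'd g x v = 0 -> derivable_cone S x v.
Proof.
move=> gv e e0.
have [C C0 AC] := linear_rV_bound A.
have [rho0 rho00 rhoP] := nbhs_dist (filterI Ux near_right_inverse).
pose rho := rho0 / 2.
have rho_gt0 : 0 < rho by rewrite divr_gt0.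
have rhoU y : `|y - x| <= rho -> U y /\ forall w, `|'d g y (A w) - w| <= 4^-1 * `|w|.
  move=> yr; apply: rhoP; apply: le_lt_trans yr _.
  by rewrite ltr_pdivrMr// mulr_natr mulr2n ltrDl.
(* With this weight a Newton step tau A w adds at most tau |w| / 4 to the penalty. *)
pose d := (4 * C)^-1.
have d0 : 0 < d by rewrite invr_gt0 mulr_gt0.
have dC : d * C = 4^-1 by rewrite /d invfM -mulrA mulVf ?mulr1// gt_eqF.
have v1 : 0 < `|v| + 1 by rewrite ltr_wpDl.
(* Makes the residual at [x + t *: v] at most d e t, which forces the minimiser to lie within e t of
   that point. *)
have eta0 : 0 < d * e / (`|v| + 1) by rewrite divr_gt0// mulr_gt0.
have [r0 r00 r0P] := nbhs_dist (differentiable_near (dg (nbhs_singleton Ux)) eta0).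
have ve : 0 < `|v| + e + 1 by rewrite addr_gt0 ?ltr_wpDl.
(* Keeps the minimiser strictly inside the ball, so that a short step from it is still
   admissible. *)
exists (Num.min rho r0 / (`|v| + e + 1)).
  by rewrite divr_gt0// lt_min rho_gt0.
move=> t /andP[t0]; rewrite ltr_pdivlMr// lt_min => /andP[trho tr0].
pose phi s := `|g s - a| + d * `|s - (x + t *: v)|.
pose B := [set y | `|y - x| <= rho].
have tv : `|x + t *: v - x| = t * `|v| by rewrite addrC addKr normrZ gtr0_norm.
have tv_le : t * `|v| <= t * (`|v| + e + 1).
  by rewrite ler_pM2l// -addrA lerDl addr_ge0 ?ltW.
have Btv : B (x + t *: v) by rewrite /B/= tv (le_trans tv_le)// ltW.
have phitv : phi (x + t *: v) <= d * (e * t).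
  rewrite /phi subrr normr0 mulr0 addr0.
  have /r0P : `|x + t *: v - x| < r0 by rewrite tv (le_lt_trans tv_le).
  rewrite gx tv (addrC x) addrK linearZ/= gv scaler0 subr0 => /le_trans; apply.
  have -> : d * e / (`|v| + 1) * (t * `|v|) = d * (e * t) * (`|v| / (`|v| + 1)).
    by field; rewrite gt_eqF.
  have det0 : 0 <= d * (e * t) by rewrite ltW// !mulr_gt0.
  by rewrite ler_piMr// ler_pdivrMr// mul1r lerDl ler01.
have phic : {within B, continuous phi}.
  apply: continuous_in_subspaceT => s; rewrite inE => /rhoU[Us _].
  apply: cvgD; last by apply: cvgM; [exact: cvg_cst|exact: dist_continuous].
  apply: cvg_norm; apply: cvgB; last exact: cvg_cst.
  exact: differentiable_continuous (dg Us).
have [s] := compact_EVT_min (ex_intro _ _ Btv) (@compact_cball _ _ x rho) phic.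
rewrite inE => Bs smin.
have s_tv : `|s - (x + t *: v)| <= e * t.
  rewrite -(ler_pM2l d0) (le_trans _ phitv)// (le_trans _ (smin _ _)) ?inE//.
  by rewrite lerDr.
exists s => //; apply: US; have [Us sA] := rhoU _ Bs; split=> //=.
apply/eqP; rewrite -subr_eq0; apply/eqP; set w := g s - a.
apply: contrapT => /eqP w0; have w0' : 0 < `|w| by rewrite normr_gt0.
have sx : `|s - x| < rho.
  rewrite -(subrKA (x + t *: v)) (le_lt_trans (ler_normD _ _))// tv.
  apply: le_lt_trans (lerD s_tv (lexx _)) _; apply: le_lt_trans trho.
  by move: `|v| => V; nra.
have [r1 r10 r1P] : exists2 r1, 0 < r1 & forall y, `|y - s| < r1 ->
    `|g y - g s - 'd g s (y - s)| <= d * `|y - s| /\ B y.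
  have [r2 r20 r2P] := nbhs_dist (differentiable_near (dg Us) d0).
  exists (Num.min r2 (rho - `|s - x|)); first by rewrite lt_min r20 subr_gt0.
  move=> y; rewrite lt_min => /andP[yr2 yrho]; split; first exact: r2P.
  rewrite /B/= -(subrKA s) (le_trans (ler_normD _ _))// -lerBrDr ltW//.
have [tau /andP[tau0 tau1] tauA] := small_scale r10 (normr_ge0 (A w)).
pose y := s - tau *: A w.
have ys : y - s = - (tau *: A w) by rewrite /y addrC addKr.
have yds : `|y - s| = tau * `|A w| by rewrite ys normrN normrZ gtr0_norm.
have [gy By] : `|g y - g s - 'd g s (y - s)| <= d * `|y - s| /\ B y.
  by apply: r1P; rewrite yds.
have := smin y; rewrite inE => /(_ By); apply/negP; rewrite -ltNge.
have dA : d * `|y - s| <= tau * (4^-1 * `|w|).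
  rewrite yds mulrCA ler_pM2l// -dC -mulrA ler_pM2l//; exact: AC.
(* The step removes tau |w|. The inexact right inverse, the linearisation error and the penalty each
   give back at most tau |w| / 4, so the total decreases. *)
have gya : `|g y - a| <= (1 - tau) * `|w| + tau * (4^-1 * `|w|) + tau * (4^-1 * `|w|).
  have -> : g y - a = (1 - tau) *: w - tau *: ('d g s (A w) - w) +
      (g y - g s - 'd g s (y - s)).
    have -> : 'd g s (y - s) = - (tau *: 'd g s (A w)) by rewrite ys linearN/= linearZ.
    move: ('d g s (A w)) => D.
    by apply/rowP => i; rewrite !mxE; ring.
  apply: le_trans (ler_normD _ _) _; apply: lerD; last exact: le_trans gy dA.
  apply: le_trans (ler_normB _ _) _; rewrite !normrZ (gtr0_norm tau0).
  rewrite ger0_norm ?subr_ge0// lerD2l ler_pM2l//; exact: sA.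
have ytv : `|y - (x + t *: v)| <= `|y - s| + `|s - (x + t *: v)|.
  by rewrite -[y - _](subrKA s) ler_normD.
apply: le_lt_trans (_ : `|g y - a| + (d * `|y - s| + d * `|s - (x + t *: v)|) < _).
  by rewrite /phi lerD2l -mulrDr ler_pM2l.
rewrite addrA /phi ltrD2r -/w; apply: le_lt_trans (lerD gya dA) _.
have : 0 < tau * `|w| by exact: mulr_gt0.
by move: `|w| => W; nra.
Qed.

End Lyusternik.

(** * First-order conditions at penalised minimisers, and intrinsic transversality *)

Section Slope.
Context {R : realType} {E : euclideanType R}.
Implicit Types (S : set E) (b c u v w x y z p : E).

Lemma inner_continuous c : continuous (inner c).
Proof.
move=> x; apply/cvgrPdist_le => e e0.
have c1 : 0 < `|c| + 1 by rewrite ltr_wpDl.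
have : \forall y \near x, `|x - y| <= e / (`|c| + 1).
  by apply: (cvgrPdist_le _ _).1; [exact: cvg_id|exact: divr_gt0].
apply: filterS => y; rewrite ler_pdivlMr// => xy.
rewrite -innerNr -innerDr (le_trans (cauchy_schwarz _ _))// (le_trans _ xy)//.
by rewrite mulrC ler_wpM2l// lerDl.
Qed.

Lemma slope_ge0 S z b d w : 0 <= d -> z != b ->
  (\forall s \near z, S s -> `|z - b| <= `|s - b| + d * `|s - z|) ->
  tangent_cone S z w -> 0 <= inner (`|z - b|^-1 *: (z - b)) w + d * `|w|.
Proof.
move=> d0 zb near_min [s [t [Ss t0 sz tc sw]]].
set r := `|z - b|; have r0 : 0 < r by rewrite normr_gt0 subr_eq0.
rewrite innerZl -(pmulr_rge0 _ r0) mulrDr mulrA mulfV ?gt_eqF// mul1r.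
rewrite -(pmulr_rge0 _ (ltr0n R 2)).
pose D k := (t k)^-1 *: (s k - z).
(* The second summand is the quadratic error from squaring; it vanishes in the limit since [s k]
   tends to [z]. *)
have Dc : 2 * (inner (z - b) (D k) + r * (d * `|D k|)) + `|D k| * `|s k - z|
    @[k --> \oo] --> 2 * (inner (z - b) w + r * (d * `|w|)) + `|w| * `|z - z|.
  apply: cvgD; last first.
    apply: cvgM; first exact: cvg_norm.
    exact: (cvg_comp _ _ sz (@dist_continuous _ _ z z)).
  apply: cvgM; first exact: cvg_cst.
  apply: cvgD; first exact: (cvg_comp _ _ sw (@inner_continuous (z - b) w)).
  apply: cvgM; first exact: cvg_cst.
  by apply: cvgM; [exact: cvg_cst|exact: cvg_norm].
rewrite subrr normr0 mulr0 addr0 in Dc.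
apply: (ler_cvg_to (@cvg_cst _ _ _ _ _) Dc).
have rd : 0 < r / (d + 1) by rewrite divr_gt0// ltr_wpDl.
have s_min : \forall k \near \oo, S (s k) -> r <= `|s k - b| + d * `|s k - z|.
  exact: sz near_min.
have s_near : \forall k \near \oo, `|z - s k| <= r / (d + 1).
  by apply: (cvgrPdist_le _ _).1 sz _ _.
near=> k; rewrite -(pmulr_rge0 _ (t0 k)).
have skb : r <= `|s k - b| + d * `|s k - z| by near: k; apply: filterS s_min => k; exact.
have skz : `|s k - z| * (d + 1) <= r.
  by rewrite -ler_pdivlMr ?ltr_wpDl// distrC; near: k.
have -> : t k * (2 * (inner (z - b) (D k) + r * (d * `|D k|)) + `|D k| * `|s k - z|) =
    2 * inner (z - b) (s k - z) + 2 * r * d * `|s k - z| + `|s k - z| ^+ 2.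
  rewrite /D innerZr normrZ gtr0_norm ?invr_gt0//.
  by field; rewrite gt_eqF.
have := normD_sqr (z - b) (s k - z).
rewrite (addrC (z - b)) subrKA -/r.
have := normr_ge0 (s k - z); have := normr_ge0 (s k - b).
move: `|s k - z| `|s k - b| (inner _ _) skb skz => n m i skb skz m0 n0 E1.
(* Permits squaring r - d n <= m; this is why [s k] is taken within r / (d + 1) of [z]. *)
have rdn : 0 <= r - d * n by nra.
have : (r - d * n) ^+ 2 <= m ^+ 2.
  by rewrite ler_sqr ?nnegrE// lerBlDr.
rewrite E1; have : 0 <= (d * n) ^+ 2 by exact: sqr_ge0.
nra.
Unshelve. all: by end_near. Qed.

Lemma dist_le u (C : set E) c : C c -> dist u C <= `|u - c|.
Proof.
move=> Cc; apply: ge_inf; last by exists c.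
by exists 0 => _ [c' _ <-].
Qed.

(* Stands in for "submanifold near [z]": locally compact, and every vector
   splits into a tangent and a normal part. *)
Definition tangentially_split S z r :=
  compact (S `&` [set y | `|y - z| <= r]) /\
  forall x, S x -> `|x - z| <= r -> forall u, exists p,
    tangent_cone S x p /\ normal_subspace S x (u - p).

Lemma tangentially_split_le S z r r' :
  r' <= r -> tangentially_split S z r -> tangentially_split S z r'.
Proof.
move=> rr [Sc Sp]; split=> [|x Sx xr]; last by apply: Sp => //; exact: le_trans rr.
have -> : S `&` [set y | `|y - z| <= r'] =
    (S `&` [set y | `|y - z| <= r]) `&` [set y | `|y - z| <= r'].
  rewrite -setIA; congr (_ `&` _); apply/seteqP; split=> [y yr|y []//].
  by split=> //=; exact: le_trans rr.
apply: compact_closedI => //.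
rewrite (_ : mkset _ = (fun y => `|y - z|) @^-1` [set c | c <= r'])//.
apply: preimage_closed; last exact: closed_le.
by move=> y _; exact: dist_continuous.
Qed.

(** Let [p] be the tangential part of -u. Then u + p is normal, at distance |p| from [u]; since <u,
    p> = -|p|^2, the slope inequality along [p] reads |p|^2 <= d |p|. *)
Lemma dist_normal_le S z b d :
  0 <= d -> z != b ->
  (forall u, exists p, tangent_cone S z p /\ normal_subspace S z (u - p)) ->
  (\forall s \near z, S s -> `|z - b| <= `|s - b| + d * `|s - z|) ->
  exists2 n, normal_subspace S z n & `|(`|z - b|^-1 *: (z - b)) - n| <= d.
Proof.
move=> d0 zb split_z near_min; set u := _ *: _.
have [p [Tp Np]] := split_z (- u).
have up := slope_ge0 d0 zb near_min Tp.
exists (u + p).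
  by move=> v /Np; rewrite -opprD innerNl => /eqP; rewrite oppr_eq0 => /eqP.
rewrite opprD addNKr normrN.
have [->|p0] := eqVneq p 0; first by rewrite normr0.
have p_gt0 : 0 < `|p| by rewrite normr_gt0.
rewrite -(ler_pM2r p_gt0) -expr2 -inner_norm -subr_ge0.
suff -> : inner p p = - inner u p by rewrite opprK addrC.
have := Np p Tp; rewrite innerDl !innerNl => /eqP.
by rewrite subr_eq0 => /eqP.
Qed.

Lemma normal_subspaceN S z n : normal_subspace S z n -> normal_subspace S z (- n).
Proof. by move=> Sn v Tv; rewrite innerNl Sn// oppr0. Qed.

(** Derivable cones are assumed so that points of [A] and of [B] approximate z + t v at one common
    scale [t]. *)
Lemma intrinsic_derivable_cone (A B : set E) z r v :
  intrinsically_transversal_at A B z -> 0 < r ->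
  tangentially_split A z r -> tangentially_split B z r ->
  derivable_cone A z v -> derivable_cone B z v -> derivable_cone (A `&` B) z v.
Proof.
move=> [Az Bz [kappa /andP[kappa0 _] [U Uz UAB]]] r0.
have [r1 r10 r1U] := nbhs_dist Uz.
pose rho := Num.min r (r1 / 2).
have rho0 : 0 < rho by rewrite lt_min r0 divr_gt0.
have rhoU y : `|y - z| <= rho -> U y.
  move=> yr; apply: r1U; apply: le_lt_trans yr _; rewrite gt_min; apply/orP; right.
  by rewrite ltr_pdivrMr// mulr_natr mulr2n ltrDl.
have rho_r : rho <= r by rewrite ge_min lexx.
move=> /(tangentially_split_le rho_r)[Ac As] /(tangentially_split_le rho_r)[Bc Bs].
move=> Av Bv e e0.
pose d := kappa / 2; have d0 : 0 < d by rewrite divr_gt0.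
(* Minimality will give d |x - a| <= |a - b| <= 2 e1 t, hence |x - w| <= (1 + 2/d) e1 t = e t, and
   likewise for [y]. *)
pose e1 := e / (1 + 2 / d).
have d1 : 0 < 1 + 2 / d by rewrite addr_gt0// divr_gt0.
have e10 : 0 < e1 by rewrite divr_gt0.
have e1e : e1 * (1 + 2 / d) = e by rewrite divfK// gt_eqF.
have [ra ra0 raP] := Av _ e10; have [rb rb0 rbP] := Bv _ e10.
have ve : 0 < `|v| + e + 1 by rewrite addr_gt0 ?ltr_wpDl.
exists (Num.min (Num.min ra rb) (rho / (`|v| + e + 1))).
  by rewrite !lt_min ra0 rb0 divr_gt0.
move=> t /andP[t0]; rewrite !lt_min ltr_pdivlMr// => /andP[/andP[tra trb] trho].
have [a Aa aP] : exists2 s, A s & `|s - (z + t *: v)| <= e1 * t by apply: raP; rewrite t0.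
have [b Bb bP] : exists2 s, B s & `|s - (z + t *: v)| <= e1 * t by apply: rbP; rewrite t0.
set w := z + t *: v in aP bP *.
have close y : `|y - w| <= e * t -> `|y - z| < rho.
  move=> yw; rewrite -(subrKA w) (le_lt_trans (ler_normD _ _))//.
  have -> : `|w - z| = t * `|v| by rewrite /w addrC addKr normrZ gtr0_norm.
  by move: yw trho t0; move: `|y - w| `|v| => m n; nra.
have e1_le : e1 <= e.
  rewrite -[leRHS]e1e; apply: ler_peMr; first exact: ltW.
  by rewrite lerDl ltW// divr_gt0.
have far s s0 : `|s0 - w| <= e1 * t -> d * `|s - s0| <= 2 * (e1 * t) -> `|s - w| <= e * t.
  move=> s0w ss0; rewrite -(subrKA s0) (le_trans (ler_normD _ _))// -e1e.
  rewrite mulrAC mulrDr mulr1 addrC lerD//.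
  by rewrite mulrA ler_pdivlMr// mulrC (mulrC (e1 * t)).
pose f (p : E * E) := `|p.1 - p.2| + d * (`|p.1 - a| + `|p.2 - b|).
pose K := (A `&` [set y | `|y - z| <= rho]) `*` (B `&` [set y | `|y - z| <= rho]).
have fc : {within K, continuous f}.
  apply: continuous_subspaceT => -[p1 p2].
  have c1 : (fun p : E * E => p.1) @ (p1, p2) --> p1 by exact: cvg_fst.
  have c2 : (fun p : E * E => p.2) @ (p1, p2) --> p2 by exact: cvg_snd.
  apply: cvgD; first by apply: cvg_norm; exact: cvgB.
  apply: cvgM; first exact: cvg_cst.
  by apply: cvgD; apply: cvg_norm; apply: cvgB => //; exact: cvg_cst.
have ab_le : `|a - b| <= 2 * (e1 * t).
  rewrite -(subrKA w) (le_trans (ler_normD _ _))// mulr_natl mulr2n lerD//.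
  by rewrite distrC.
have Kab : K (a, b).
  by split; split=> //=; apply/ltW/close; [apply: le_trans aP _|apply: le_trans bP _];
    rewrite ler_pM2r.
have [[x y]] := compact_EVT_min (ex_intro _ _ Kab) (compact_setX Ac Bc) fc.
rewrite inE => -[[/= Ax xz] [/= By yz]] xy_min.
have fxy : f (x, y) <= 2 * (e1 * t).
  have := xy_min (a, b); rewrite inE => /(_ Kab)/le_trans; apply.
  by rewrite /f/= !subrr normr0 addr0 mulr0 addr0.
have xw : `|x - w| <= e * t.
  apply: far aP _; apply: le_trans fxy; rewrite /f/= mulrDr addrCA lerDl.
  by rewrite addr_ge0// mulr_ge0// ltW.
have yw : `|y - w| <= e * t.
  apply: far bP _; apply: le_trans fxy; rewrite /f/= mulrDr addrA lerDr.
  by rewrite addr_ge0// mulr_ge0// ltW.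
have [Bx|nBx] := pselect (B x); first by exists x.
have [Ay|nAy] := pselect (A y); first by exists y.
have xy : x != y by apply: contra_not_neq nBx => ->.
have ball_near s0 : `|s0 - w| <= e * t -> \forall s \near s0, `|s - z| <= rho.
  move=> /close s0z; apply: (@cvgr_le _ _ _ _ (fun s => `|s - z|)) s0z.
  exact: dist_continuous.
(* With [y] fixed, [x] minimises |s - y| + d |s - a| over nearby [s] in [A]; the triangle inequality
   moves the centre of the penalty from [a] to [x]. *)
have [n Nn un] : exists2 n, normal_subspace A x n &
    `|(`|x - y|^-1 *: (x - y)) - n| <= d.
  apply: dist_normal_le => //; [exact: ltW|exact: As|].
  apply: filterS (ball_near _ xw) => s sz As'.
  have := xy_min (s, y); rewrite inE => /(_ (conj (conj As' sz) (conj By yz))).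
  rewrite /f/= !mulrDr !addrA lerD2r.
  have : `|s - a| <= `|s - x| + `|x - a| by rewrite -[s - a](subrKA x) ler_normD.
  by rewrite -(ler_pM2l d0); lra.
have [m Nm um] : exists2 n, normal_subspace B y n &
    `|(`|y - x|^-1 *: (y - x)) - n| <= d.
  apply: dist_normal_le => //; [exact: ltW|by rewrite eq_sym|exact: Bs|].
  apply: filterS (ball_near _ yw) => s sz Bs'.
  have := xy_min (x, s); rewrite inE => /(_ (conj (conj Ax xz) (conj Bs' sz))).
  rewrite /f/= !mulrDr (distrC x y) (distrC x s).
  have : `|s - b| <= `|s - y| + `|y - b| by rewrite -[s - b](subrKA y) ler_normD.
  by rewrite -(ler_pM2l d0); lra.
have := UAB x y (rhoU _ xz) (rhoU _ yz) Ax nBx By nAy.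
rewrite /= leNgt => /negP; case; apply: le_lt_trans (_ : d < kappa); last first.
  by rewrite /d ltr_pdivrMr// mulr_natr mulr2n ltrDl.
rewrite ge_max; apply/andP; split.
  (* The unit vectors seen from [x] and from [y] are opposite; normal subspaces are symmetric, so
     the sign is harmless. *)
  apply: le_trans (dist_le _ (normal_subspaceN Nm)) _.
  by move: um; rewrite opprK -normrN opprB addrC -scalerN opprB (distrC y x).
apply: le_trans (dist_le _ _) un; exists (- n); first exact: normal_subspaceN.
by rewrite opprK.
Qed.

End Slope.

(** * Sets cut out locally by smooth equations *)

Section Chart.
Context {R : realType} {E : euclideanType R}.
Implicit Types (S U : set E).

(** One form for both sets: [level_set h X] with [U] the whole space and [a] equal to [h X], and [M]
    with a local defining map and [a] equal to 0. The rank condition is imposed separately at each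
    point. *)
Definition chart {q : nat} S U (g : E -> 'rV[R]_q) (a : 'rV[R]_q) :=
  [/\ open U, smooth_on U g & S `&` U = [set y | g y = a] `&` U].

Section Cone.
Context {q : nat} (S U : set E) (g : E -> 'rV[R]_q) (a : 'rV[R]_q) (x : E).
Hypotheses (gS : chart S U g a) (Ux : U x) (Sx : S x).
Hypothesis gr : full_rank (differential g x).

Lemma chart_derivable_cone v : differential g x v = 0 -> derivable_cone S x v.
Proof.
have [oU gs SU] := gS; have [dg dgc] := gs 1%N.
have gx : g x = a by have [] : ([set y | g y = a] `&` U) x by rewrite -SU.
rewrite lfunE; apply: (@lyusternik _ _ _ U _ _ a _ (differential g x)^-1%VF) => //.
- exact: open_nbhs_nbhs.
- by move=> w; exact: dgc.
- by move=> w; rewrite -lfunE; exact: full_rank_surj.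
- by rewrite setIC -SU; exact: subIsetl.
Qed.

(** The tangent cone lies in the kernel, the kernel in the derivable cone, and the latter in the
    tangent cone. *)
Lemma chart_tangent_cone : tangent_cone S x = [set v | differential g x v = 0].
Proof.
have [oU gs SU] := gS; have [dg _] := gs 1%N.
have gx : g x = a by have [] : ([set y | g y = a] `&` U) x by rewrite -SU.
apply/seteqP; split=> v /=; last first.
  by move=> gv; apply/derivable_tangent_cone/chart_derivable_cone.
rewrite lfunE; apply: (@tangent_cone_sub_ker _ _ _ S U g a) => //.
- exact: open_nbhs_nbhs.
- by rewrite SU; exact: subIsetl.
- exact: dg.
Qed.

Lemma chart_split u : exists p, tangent_cone S x p /\ normal_subspace S x (u - p).
Proof.
have [P PE] := ker_projection gr; have [GP oP] := PE u.
by exists (P u); rewrite /normal_subspace chart_tangent_cone.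
Qed.

End Cone.

(** [S] may fail to be closed, but on a ball inside [U] it is given by an equation in a continuous
    map, hence is closed in a compact ball. *)
Lemma chart_compact {q : nat} S U (g : E -> 'rV[R]_q) a z r :
  chart S U g a -> [set y | `|y - z| <= r] `<=` U ->
  compact (S `&` [set y | `|y - z| <= r]).
Proof.
move=> [oU gs SU] BU; have [dg _] := gs 1%N.
set B := mkset _ in BU *.
have Bc : closed B.
  apply: (compact_closed (@norm_hausdorff _ E)); exact: compact_cball.
apply: (subclosed_compact _ (@compact_cball _ _ z r)); last exact: subIsetr.
move=> y yc; have By : B y.
  by apply: Bc => V /yc[w [[_ Bw] Vw]]; exists w.
split=> //; suff gy : g y = a.
  by have [] : (S `&` U) y by rewrite SU; split=> //; exact: BU.
apply: contrapT => /eqP gya.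
have /cvgrPdist_lt/(_ `|g y - a|) := differentiable_continuous (dg y (BU y By)).
rewrite normr_gt0 subr_eq0 => /(_ gya)/yc[w [[Sw Bw]]] /=.
have [-> _] : ([set y | g y = a] `&` U) w by rewrite -SU; split=> //; exact: BU.
by rewrite ltxx.
Qed.

Lemma level_set_tangentially_split {q : nat} (h : E -> 'rV[R]_q) (K : set E) x :
  smooth_on setT h -> open K -> K x ->
  (forall y, K y -> full_rank (differential h y)) ->
  exists2 r, 0 < r & tangentially_split (level_set h x) x r.
Proof.
move=> hs oK Kx hr.
have hc : chart (level_set h x) setT h (h x) by split=> //; exact: openT.
have [r0 r00 r0K] := nbhs_dist (open_nbhs_nbhs (conj oK Kx)).
exists (r0 / 2); first by rewrite divr_gt0.
split=> [|y hy yx u]; first by apply: chart_compact hc _.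
apply: (chart_split hc) => //; apply/hr/r0K; apply: le_lt_trans yx _.
by rewrite ltr_pdivrMr// mulr_natr mulr2n ltrDl.
Qed.

Lemma submanifold_tangentially_split (M : set E) x : submanifold M -> M x ->
  exists2 r, 0 < r & tangentially_split M x r.
Proof.
move=> [c Mc] Mx; have [U [g [oU Ux gs _ MU]]] := Mc x Mx.
have [r0 r00 r0U] := nbhs_dist (open_nbhs_nbhs (conj oU Ux)).
exists (r0 / 2); first by rewrite divr_gt0.
split=> [|y My _ u].
  apply: (@chart_compact _ _ U g 0) => // y /= yx; apply: r0U.
  by apply: le_lt_trans yx _; rewrite ltr_pdivrMr// mulr_natr mulr2n ltrDl.
(* The defining map [g] comes with full rank at [x] only, so the splitting at [y] uses a defining
   map around [y]. *)
have [V [k [oV Vy ks kr MV]]] := Mc y My.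
exact: (@chart_split _ M V k 0).
Qed.

End Chart.

Unset Implicit Arguments.

(** Equating [nearest] with a singleton asserts that the nearest point exists and is unique, which
    an equation for [proj] would not express. *)
Theorem proposition5p2 (R : realType) (E : euclideanType R) (q : nat)
    (M : set E) (h : E -> 'rV[R]_q) (K : set E) (X : E) :
  submanifold M ->
  smooth_on setT h ->
  open K ->
  [set Y | h Y = 0] `<=` K ->
  (forall Y, K Y -> full_rank (differential h Y)) ->
  K X -> M X ->
  intrinsically_transversal_at (level_set h X) M X ->
  (forall xi : E,
     nearest (tangent_cone (level_set h X `&` M) X) xi =
     [set proj (tangent_cone M X) xi -
          Phi h M X (mp_pinv (DhPhi h M X)
            (differential h X (proj (tangent_cone M X) xi)))]) /\
  (transversal_at (level_set h X) M X ->
     bijective (differential h X \o Phi h M X) /\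
     (cancel (differential h X \o Phi h M X) (mp_pinv (DhPhi h M X)) /\
      cancel (mp_pinv (DhPhi h M X)) (differential h X \o Phi h M X))).
Proof.
move=> Msub hs oK _ hr KX MX HM.
have hc : chart (level_set h X) setT h (h X) by split=> //; exact: openT.
have [c Mc] := Msub; have [U [g [oU UX gs gr MU]]] := Mc X MX.
have gc : chart M U g 0 by split.
have TM := chart_tangent_cone gc UX MX gr.
have HX : level_set h X X by [].
have TH := chart_tangent_cone hc I HX (hr X KX).
have THM : tangent_cone (level_set h X `&` M) X =
    [set v | differential h X v = 0 /\ differential g X v = 0].
  apply/seteqP; split=> v /=.
    move=> Tv; split.
      by have := sub_tangent_cone (@subIsetl _ _ _) Tv; rewrite TH.
    by have := sub_tangent_cone (@subIsetr _ _ _) Tv; rewrite TM.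
  (* This inclusion rests on intrinsic transversality; the converse is monotonicity of the tangent
     cone. *)
  move=> [hv gv]; apply: derivable_tangent_cone.
  have [r1 r10 /tangentially_split_le Hr] := level_set_tangentially_split hs oK KX hr.
  have [r2 r20 /tangentially_split_le Mr] := submanifold_tangentially_split Msub MX.
  apply: (@intrinsic_derivable_cone _ _ _ _ _ (Num.min r1 r2) _ HM).
  - by rewrite lt_min r10.
  - by apply: Hr; rewrite ge_min lexx.
  - by apply: Mr; rewrite ge_min lexx orbT.
  - exact: (chart_derivable_cone hc I HX (hr X KX)).
  - exact: (chart_derivable_cone gc UX MX gr).
split=> [xi|trans]; first by rewrite THM; exact: nearest_level_tangent gr TM xi.
have [|hK Kh] := DhPhi_inverse gr TM (hr X KX).
  move=> x; have : setT x by []; rewrite -trans => -[v Tv [w Tw <-]].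
  by exists v, w; rewrite TH TM in Tv Tw; split.
by split=> //; exists (mp_pinv (DhPhi h M X)).
Qed.
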